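(* Let $1<\beta<2$ and consider the Bernoulli system $G=\{g_0,g_1\}$ with slope $\beta$ on $[0,1]$. Suppose there is a point $y\in[0,1]$ such that the orbit of $y$ contains two different paths from $y$ to cycles (or finite invariant sets); that is, there are 01-words $v,v'$ (possibly empty) and nonempty 01-words $w,w'$ such that $g_w(g_v(y))=g_v(y)$ and $g_{w'}(g_{v'}(y))=g_{v'}(y)$ (all these expressions being defined), and the infinite sequences $vwww\dots$ and $v'w'w'w'\dots$ are different. Then $\beta$ is an algebraic integer. If, moreover, the orbit of $y$ under $G$ is finite, then $\beta$ is a weak Perron number.
   Context: With $t=1/\beta$, let $g_0:[0,t]\to[0,1]$, $g_0(x)=\beta x$, and $g_1:[1-t,1]\to[0,1]$, $g_1(x)=\beta x+1-\beta$. For a 01-word $w=w_1\dots w_n$ put $g_w=g_{w_n}\cdots g_{w_1}$ (first $g_{w_1}$ is applied), a partially defined map; for the empty word $g_w$ is the identity. The set of successors of $x$ is $G(x)=\{g_i(x): x \text{ in the domain of } g_i\}$, $G^0(x)=\{x\}$, $G^q(x)=G(G^{q-1}(x))$, and the orbit of $x$ is $\bigcup_{q\ge0}G^q(x)$. A weak Perron number is a real algebraic integer $\beta>1$ such that all algebraic conjugates $\lambda$ of $\beta$ fulfil $|\lambda|\le\beta$. *)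

(* Defs.v *)
From HB Require Import structures.
From mathcomp Require Import all_boot all_order all_algebra.
From mathcomp Require Import all_classical all_reals.
From mathcomp Require Import complex.

Set Implicit Arguments.
Unset Strict Implicit.
Unset Printing Implicit Defensive.

Import Order.TTheory GRing.Theory Num.Theory.

Local Open Scope classical_set_scope.
Local Open Scope ring_scope.

(* Letters are booleans: [false] is the letter 0 and [true] is the letter 1. *)

Definition gdom (R : realType) (beta : R) (i : bool) (x : R) : bool :=
  if i then 1 - beta^-1 <= x <= 1 else 0 <= x <= beta^-1.

(* The partial map g_i; [None] means "undefined at x". *)
Definition g (R : realType) (beta : R) (i : bool) (x : R) : option R :=
  if gdom beta i x then
    Some (if i then beta * x + 1 - beta else beta * x)
  else None.

(* g_w = g_{w_n} ... g_{w_1}: the first letter of w is applied first. *)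
Definition gword (R : realType) (beta : R) (w : seq bool) (x : R) : option R :=
  foldl (fun ox i => obind (g beta i) ox) (Some x) w.

Definition successors (R : realType) (beta : R) (x : R) : set R :=
  [set z | exists i, g beta i x = Some z].

Fixpoint iter_successors (R : realType) (beta : R) (q : nat) (x : R) : set R :=
  if q is q'.+1 then
    \bigcup_(z in iter_successors beta q' x) successors beta z
  else [set x].

Definition bernoulli_orbit (R : realType) (beta : R) (x : R) : set R :=
  \bigcup_q iter_successors beta q x.

Definition path_to_cycle (R : realType) (beta y : R) (v w : seq bool) : Prop :=
  w <> [::] /\
  exists z : R, gword beta v y = Some z /\ gword beta w z = Some z.

(* The infinite 01-sequence vwww..., for a nonempty word w. *)
Definition ult_periodic (v w : seq bool) (n : nat) : bool :=
  if (n < size v)%N then nth false v n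
  else nth false w ((n - size v) %% size w)%N.

Definition algebraic_integer (R : realType) (x : R) : Prop :=
  integralOver (intr : int -> R) x.

Definition minimal_poly (R : realType) (p : {poly rat}) (x : R) : Prop :=
  [/\ p \is monic, irreducible_poly p & root (map_poly ratr p) x].

(* The conjugates of x, x itself included, are the complex roots of its minimal
   polynomial over the rationals. *)
Definition conjugate (R : realType) (x : R) (lambda : R[i]) : Prop :=
  exists p : {poly rat}, minimal_poly p x /\ root (map_poly ratr p) lambda.

(* The norm on [R[i]] takes its values in [R[i]], hence the embedding of beta;
   between real elements the order of [R[i]] is that of [R]. *)
Definition weak_perron (R : realType) (beta : R) : Prop :=
  [/\ algebraic_integer beta, 1 < beta &
      forall lambda : R[i], conjugate beta lambda -> `|lambda| <= (beta%:C)%C].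

(* Main.v *)
(* Two trajectories of y with digit difference d, first nonzero at time m, are
   at distance (1 - beta) A_k(beta) at time m + k, where the integer polynomial
   A_k = sum_(i < k) d_(m+i) X^(k-1-i) has leading coefficient d_m = 1 or -1.
   Both trajectories are eventually periodic, with a common period L, so
   A_(N+L) - A_N vanishes at beta for N large, and it is monic up to sign.
   At time m both maps are defined at the common point, so the orbit meets
   [1 - t, t].  When the orbit is finite, so is the set D of positive differences
   of its points; beta times a difference of two points in a common domain is
   again in D, and every other difference is cut at the point of the orbit in
   [1 - t, t] into two such ones.  Thus D is a positive eigenvector, of
   eigenvalue beta, of a matrix of natural numbers; beta is the spectral radius
   of this matrix, whose eigenvalues include the conjugates of beta. *)
Require Import Defs.
From mathcomp Require Import all_boot all_order all_algebra.
From mathcomp Require Import all_classical all_reals.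
From mathcomp Require Import zify ring lra complex.

Set Implicit Arguments.
Unset Strict Implicit.
Unset Printing Implicit Defensive.

Import Order.TTheory GRing.Theory Num.Theory.

Local Open Scope ring_scope.

(** * Infinite trajectories driven by 01-sequences *)

Section Trajectories.
Variables (R : realType) (beta : R).

Lemma gword_cons i w x :
  gword beta (i :: w) x = obind (gword beta w) (g beta i x).
Proof.
rewrite /gword /=; case: (g beta i x) => //=.
by elim: w.
Qed.

Definition trajectory (a : nat -> bool) (x : nat -> R) : Prop :=
  forall n, g beta (a n) (x n) = Some (x n.+1).

Fixpoint follow (a : nat -> bool) (y : R) (n : nat) : R :=
  if n is n'.+1 then odflt 0 (g beta (a n') (follow a y n')) else y.

(** The starting time [n0] is arbitrary so that this serves both the prefix [v] and every lap of the
    cycle [w]. *)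
Lemma follow_gword a y u n0 z :
  gword beta u (follow a y n0) = Some z ->
  (forall i, (i < size u)%N -> a (n0 + i)%N = nth false u i) ->
  (forall i, (i < size u)%N ->
     g beta (a (n0 + i)%N) (follow a y (n0 + i))
       = Some (follow a y (n0 + i).+1)) /\
  follow a y (n0 + size u) = z.
Proof.
elim: u n0 => [|c u IH] n0.
  by move=> [<-] _; split=> //=; rewrite addn0.
rewrite gword_cons; case E: (g beta c _) => [x1|] //= Hu Ha.
have a0 : a n0 = c by have := Ha 0%N isT; rewrite addn0.
have x1E : follow a y n0.+1 = x1 by rewrite /= a0 E.
have [||Hs He] := IH n0.+1.
- by rewrite x1E.
- by move=> i iu; rewrite addSnnS; exact: (Ha i.+1).
split; last by rewrite -He addSnnS.
case=> [_|i iu]; first by rewrite addn0 a0 E.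
by rewrite -addSnnS; exact: Hs.
Qed.

Lemma path_to_cycle_trajectory y v w : path_to_cycle beta y v w ->
  exists x : nat -> R, [/\ x 0%N = y, trajectory (ult_periodic v w) x &
    forall n k, (size v <= n)%N -> x (n + k * size w)%N = x n].
Proof.
move=> [w0 [z [Hv Hw]]].
have sw : (0 < size w)%N by case: w w0 {Hw}.
pose a := ult_periodic v w; pose x := follow a y.
have [Sv Ev] : (forall i, (i < size v)%N -> g beta (a i) (x i) = Some (x i.+1))
    /\ x (size v) = z.
  apply: (@follow_gword a y v 0 z) => // i iv.
  by rewrite add0n /a /ult_periodic iv.
have cycle k : x (size v + k * size w)%N = z ->
    (forall i, (i < size w)%N -> g beta (a (size v + k * size w + i)%N)
       (x (size v + k * size w + i)%N)
       = Some (x (size v + k * size w + i).+1)) /\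
    x (size v + k * size w + size w)%N = z.
  move=> Hz; apply: follow_gword; first by rewrite -/x Hz.
  move=> i iw; rewrite /a /ult_periodic.
  rewrite -addnA ltnNge leq_addr /= addKn.
  by rewrite modnMDl modn_small.
have xz k : x (size v + k * size w)%N = z.
  elim: k => [|k IH]; first by rewrite mul0n addn0.
  by have [_ <-] := cycle k IH; rewrite mulSn [(size w + _)%N]addnC addnA.
have aS n : (size v <= n)%N -> a (n + size w)%N = a n.
  move=> vn; rewrite /a /ult_periodic !ltnNge (leq_trans vn) ?leq_addr // vn /=.
  by rewrite -addnBAC // modnDr.
(* At time [size v] this is the return to [z]; afterwards equal points reading equal digits stay
   equal. *)
have xS n : (size v <= n)%N -> x (n + size w)%N = x n.
  move=> vn; rewrite -(subnK vn); elim: (n - size v)%N => [|m IH].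
    by rewrite add0n -{1}(mul1n (size w)) xz Ev.
  rewrite !addSn /x /= -/x IH aS //; exact: leq_addl.
exists x; split=> // [n|n k vn].
  case: (ltnP n (size v)) => [/Sv //|vn].
  rewrite -/a -(subnKC vn) (divn_eq (n - size v) (size w)) addnA.
  by apply: (cycle _ (xz _)).1; rewrite ltn_mod.
elim: k => [|k IH]; first by rewrite addn0.
by rewrite mulSn [(size w + _)%N]addnC addnA xS ?IH // (leq_trans vn) ?leq_addr.
Qed.

Lemma trajectory_orbit a x n :
  trajectory a x -> bernoulli_orbit beta (x 0%N) (x n).
Proof.
move=> Hx; exists n => //; elim: n => [|n IH] //=.
by exists (x n) => //; exists (a n).
Qed.

Lemma orbit_g y i x z :
  bernoulli_orbit beta y x -> g beta i x = Some z -> bernoulli_orbit beta y z.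
Proof. by move=> [q _ Hx] E; exists q.+1 => //=; exists x => //; exists i. Qed.

(** One formula, affine in the digit, covers both maps, so that differences of trajectories are
    linear in the digit differences. *)
Lemma gE i x z : g beta i x = Some z ->
  gdom beta i x /\ z = beta * x + (1 - beta) * i%:R.
Proof.
rewrite /g; case: ifP => // D [<-]; split=> //.
by case: i {D}; rewrite ?mulr1 ?mulr0 ?addr0 // addrA.
Qed.

End Trajectories.

(** * Integer polynomials in Horner form and integrality *)

Fixpoint digit_poly (d : nat -> int) (n : nat) : {poly int} :=
  if n is n'.+1 then digit_poly d n' * 'X + (d n')%:P else 0.

Lemma size_lead_digit_poly d n : d 0%N != 0 ->
  size (digit_poly d n.+1) = n.+1 /\ lead_coef (digit_poly d n.+1) = d 0%N.
Proof.
move=> d0; elim: n => [|n [IHs IHl]].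
  by rewrite /= mul0r add0r size_polyC d0 lead_coefC.
have s : size (digit_poly d n.+1 * 'X) = n.+2.
  by rewrite size_mulX ?IHs // -size_poly_eq0 IHs.
have lt : (size (d n.+1)%:P < size (digit_poly d n.+1 * 'X)%R)%N.
  by rewrite s (leq_ltn_trans (size_polyC_leq1 _)).
rewrite [digit_poly d n.+2]/=; split.
  by rewrite size_polyDl.
by rewrite lead_coefDl // lead_coefMX.
Qed.

Lemma algebraic_integer_digits (R : realType) (b : R) (d : nat -> int) N L :
  d 0%N * d 0%N = 1 -> (0 < N)%N -> (0 < L)%N ->
  (map_poly intr (digit_poly d (N + L))).[b]
    = (map_poly intr (digit_poly d N)).[b] ->
  algebraic_integer b.
Proof.
move=> dd N0 L0 E.
have d0 : d 0%N != 0 by apply: contra_eqN dd => /eqP ->; rewrite mul0r eq_sym oner_eq0.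
(* As [L] is positive, the first polynomial has the larger degree and leads with [d 0], which is its
   own inverse; the factor makes [p] monic. *)
pose p := d 0%N *: (digit_poly d (N + L) - digit_poly d N).
case: N N0 E @p => // N _ E p.
have [s l] := size_lead_digit_poly N d0.
have [s' l'] := size_lead_digit_poly (N + L) d0.
exists p.
  rewrite monicE lead_coefZ lead_coefDl ?l' ?dd //.
  by rewrite size_polyN s s' ltnS -{1}(addn0 N) ltn_add2l.
apply/rootP; rewrite /p map_polyZ /= hornerZ rmorphB /= hornerD hornerN E.
by rewrite subrr mulr0.
Qed.

(** * A Perron-Frobenius bound for conjugates *)

(* The positive vector s is an eigenvector of a nonnegative matrix M; if u is
   another one, for lambda, comparing entries where |u_j| / s_j is maximal gives
   |lambda| <= b. *)
Lemma conjugate_norm_le (R : realType) (b : R) (s : seq R) :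
  s != [::] -> {in s, forall x, 0 < x} ->
  {in s, forall x, b * x \in s \/
     exists x1 x2, [/\ x1 \in s, x2 \in s & b * x = x1 + x2]} ->
  forall lambda : R[i], conjugate b lambda -> `|lambda| <= (b%:C)%C.
Proof.
move=> s0 spos sb lambda [p [[pmon pirr pb] plam]].
set n := size s; pose e (i : 'I_n) := s`_i.
have es i : e i \in s by exact: mem_nth.
have idx x : x \in s -> exists i, e i = x.
  move=> xs; have lt : (index x s < n)%N by rewrite index_mem.
  by exists (Ordinal lt); rewrite /e /= nth_index.
have hc j : exists c : 'I_n -> nat, b * e j = \sum_i e i * (c i)%:R.
  have delta k : \sum_i e i * (i == k)%:R = e k.
    rewrite (bigD1 k) //= eqxx mulr1 big1 ?addr0 // => i /negPf ->.
    by rewrite mulr0.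
  case: (sb _ (es j)) => [/idx[k <-]|[x1 [x2 [/idx[k1 <-] /idx[k2 <-] ->]]]].
    by exists (fun i => (i == k) : nat); rewrite delta.
  exists (fun i => (i == k1) + (i == k2))%N.
  under eq_bigr => i _ do rewrite natrD mulrDr.
  by rewrite big_split /= !delta.
have [c cE] := fin_all_exists hc.
(* Eigenvectors are row vectors, so column [j] holds the coefficients of [b * e j]. Rational entries
   can be mapped to both [R] and [R[i]]. *)
pose M : 'M[rat]_n := \matrix_(i, j) (c j i)%:R.
have ratM (F : numFieldType) : map_mx ratr M = \matrix_(i, j) (c j i)%:R :> 'M[F]_n.
  by apply/matrixP => i j; rewrite !mxE ratr_nat.
have n0 : (0 < n)%N by rewrite lt0n size_eq0.
pose i0 := Ordinal n0.
have rootb : root (map_poly ratr (char_poly M)) b.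
  rewrite map_char_poly -eigenvalue_root_char; apply/eigenvalueP.
  exists (\row_i e i).
    apply/rowP => j; rewrite ratM !mxE cE.
    by apply: eq_bigr => i _; rewrite !mxE.
  apply/eqP => /rowP/(_ i0); rewrite !mxE => e0.
  by have := spos _ (es i0); rewrite e0 ltxx.
(* Otherwise the irreducible [p] would be coprime to the characteristic polynomial, yet both vanish
   at [b]. *)
have pM : p %| char_poly M.
  rewrite -[_ %| _]negbK -irreducible_poly_coprime //.
  rewrite -(coprimep_map (ratr : {rmorphism rat -> R})).
  by apply/negP => /coprimep_root /(_ pb); rewrite rootE in rootb; rewrite rootb.
have : root (map_poly ratr (char_poly M)) lambda.
  by apply: root_dvdp plam; rewrite dvdp_map.
rewrite map_char_poly -eigenvalue_root_char => /eigenvalueP[u uM u0].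
pose r (i : 'I_n) : R := complex.Re `|u ord0 i|.
have rE i : `|u ord0 i| = (r i)%:C%C by rewrite /r normc_def.
have epos i : 0 < e i by exact: spos.
have [j _ jmax] := @arg_maxP _ R 'I_n i0 xpredT (fun i => r i / e i) isT.
pose m := r j / e j.
have rle i : r i <= m * e i by rewrite -ler_pdivrMr //; exact: jmax.
have rj0 : 0 < r j.
  have /rV0Pn[i ui] := u0; have ri : 0 < r i by rewrite -ltcR -rE normr_gt0.
  have : 0 < m by rewrite -(pmulr_lgt0 _ (epos i)) (lt_le_trans ri).
  by rewrite /m pmulr_lgt0 // invr_gt0.
(* In column [j] of [u M = lambda u], bound each [r i] by [m * e i]; the sum becomes
   [m * (b * e j)], which is [b * r j] by the choice of [m]. *)
have key : `|lambda| * (r j)%:C%C <= (b * r j)%:C%C.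
  move/rowP/(_ j): uM; rewrite ratM !mxE -rE -normrM => <-.
  apply: le_trans (ler_norm_sum _ _ _) _.
  have -> : b * r j = \sum_i m * e i * (c j i)%:R.
    under eq_bigr => i _ do rewrite -mulrA.
    by rewrite -mulr_sumr -cE mulrCA /m divfK // gt_eqF.
  rewrite rmorph_sum /=; apply: ler_sum => i _.
  rewrite !mxE normrM normr_nat rmorphM rmorph_nat rE.
  by rewrite ler_wpM2r // lecR.
by rewrite rmorphM /= ler_pM2r ?ltcR in key.
Qed.

(** * Differences of points in a finite orbit *)

Lemma finite_orbit_weak_perron (R : realType) (beta y m : R) :
  1 < beta < 2 -> 0 <= y <= 1 ->
  bernoulli_orbit beta y m -> 1 - beta^-1 <= m <= beta^-1 ->
  finite_set (bernoulli_orbit beta y) ->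
  forall lambda : R[i], conjugate beta lambda -> `|lambda| <= (beta%:C)%C.
Proof.
move=> /andP[b1 b2] hy Om mmid /finite_seqP[s Os].
have inO x : bernoulli_orbit beta y x <-> x \in s by rewrite Os.
have b0 : 0 < beta by lra.
have bV : beta * beta^-1 = 1 by rewrite divff // gt_eqF.
have V0 : 0 < beta^-1 by rewrite invr_gt0.
have V12 : 1 < 2 * beta^-1 by nra.
have V1 : beta^-1 < 1 by nra.
have s01 x : x \in s -> 0 <= x <= 1.
  move=> /inO[q _]; elim: q x => [x /= -> //|q IH x [z /IH z01 [i /gE[]]]].
  by case: i => /= /andP[D1 D2] ->; apply/andP; split; nra.
have g0in x : x \in s -> x <= beta^-1 -> beta * x \in s.
  move=> xs xt; apply/inO; apply: (@orbit_g _ _ y false x); first exact/inO.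
  by have /andP[x0 x1] := s01 _ xs; rewrite /g /= x0 xt.
have g1in x : x \in s -> 1 - beta^-1 <= x -> beta * x + 1 - beta \in s.
  move=> xs xt; apply/inO; apply: (@orbit_g _ _ y true x); first exact/inO.
  by have /andP[x0 x1] := s01 _ xs; rewrite /g /= xt x1.
have /inO ms := Om; have /andP[m1 m2] := mmid.
pose D := [seq q <- [seq x2 - x1 | x1 <- s, x2 <- s] | 0 < q].
have inD x1 x2 : x1 \in s -> x2 \in s -> x1 < x2 -> x2 - x1 \in D.
  move=> x1s x2s lt; rewrite mem_filter subr_gt0 lt /=.
  by apply/allpairsP; exists (x1, x2).
apply: (@conjugate_norm_le _ _ D).
(* The two images of [m] differ by [beta - 1], so [D] is not empty. *)
- have : beta * m - (beta * m + 1 - beta) \in D.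
    by apply: inD; [exact: g1in|exact: g0in|lra].
  by case: D inD.
- by move=> x; rewrite mem_filter => /andP[].
move=> x; rewrite mem_filter => /andP[x0 /allpairsP[[x1 x2] /= [x1s x2s xE]]].
rewrite {x}xE subr_gt0 in x0 *.
have [x2t|x2t] := leP x2 beta^-1.
  left; rewrite mulrBr; apply: inD; [apply: g0in => //; lra|exact: g0in|nra].
have [x1t|x1t] := leP (1 - beta^-1) x1.
  left; have -> : beta * (x2 - x1) =
    (beta * x2 + 1 - beta) - (beta * x1 + 1 - beta) by ring.
  by apply: inD; [exact: g1in|apply: g1in => //; lra|nra].
(* Now [x1 < 1 - beta^-1 <= m <= beta^-1 < x2]: the map for 0 acts on [x1] and [m], the map for 1 on
   [m] and [x2]. *)
right; exists (beta * m - beta * x1).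
exists ((beta * x2 + 1 - beta) - (beta * m + 1 - beta)); split; last by ring.
  by apply: inD; [apply: g0in => //; lra|exact: g0in|nra].
by apply: inD; [exact: g1in|apply: g1in => //; lra|nra].
Qed.

(** * Comparison of two trajectories and conclusion *)

Lemma trajectory_diff (R : realType) (beta : R) a a' x x' m :
  trajectory beta a x -> trajectory beta a' x' -> x m = x' m ->
  forall k, x (m + k)%N - x' (m + k)%N = (1 - beta) * (map_poly intr
    (digit_poly (fun i => (a (m + i)%N)%:Z - (a' (m + i)%N)%:Z) k)).[beta].
Proof.
move=> Hx Hx' E; elim=> [|k IH] /=.
  by rewrite addn0 E subrr rmorph0 horner0 mulr0.
rewrite addnS; have [_ ->] := gE (Hx (m + k)%N); have [_ ->] := gE (Hx' (m + k)%N).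
(* The difference is multiplied by [beta] and gains [1 - beta] times the digit difference: the
   Horner recursion. *)
rewrite rmorphD rmorphM /= map_polyX map_polyC /= !hornerE rmorphB /= mulrDr.
rewrite mulrA -IH; ring.
Qed.

Theorem theorem7 (R : realType) (beta : R) (hbeta1 : 1 < beta) (hbeta2 : beta < 2)
  (y : R) (hy : 0 <= y <= 1)
  (hpaths : exists v w v' w' : seq bool,
    path_to_cycle beta y v w /\ path_to_cycle beta y v' w' /\
    exists n : nat, ult_periodic v w n <> ult_periodic v' w' n) :
  algebraic_integer beta /\
  (finite_set (bernoulli_orbit beta y) -> weak_perron beta).
Proof.
have [v [w [v' [w' [P [P' [n0 /eqP Hn0]]]]]]] := hpaths.
have [x [x0 Hx Px]] := path_to_cycle_trajectory P.
have [x' [x'0 Hx' Px']] := path_to_cycle_trajectory P'.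
have sw : (0 < size w * size w')%N.
  by case: P P' => /eqP ? _ [/eqP ? _]; rewrite muln_gt0 !lt0n !size_eq0; apply/andP.
set a := ult_periodic v w in Hx Hn0; set a' := ult_periodic v' w' in Hx' Hn0.
have ex : exists n, a n != a' n by exists n0.
have [m am mmin] := ex_minnP ex.
have xm : x m = x' m.
  suff : forall n, (n <= m)%N -> x n = x' n by apply.
  elim=> [|n IH] nm; first by rewrite x0 x'0.
  have an : a n = a' n.
    by apply/eqP; apply: contraLR nm => /mmin; rewrite -leqNgt.
  by have := Hx n; rewrite an IH ?(ltnW nm) // Hx' => -[].
have int : algebraic_integer beta.
  (* Time [m + N] lies beyond both prefixes, and [L] is a multiple of both periods. *)
  pose N := (size v + size v').+1; pose L := (size w * size w')%N.
  apply: (@algebraic_integer_digits _ _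
    (fun i => (a (m + i)%N)%:Z - (a' (m + i)%N)%:Z) N L) => //.
    by rewrite addn0; move: am; case: (a m); case: (a' m).
  have b0 : 1 - beta != 0 by rewrite subr_eq0 lt_eqF.
  apply: (mulfI b0); rewrite -!(trajectory_diff Hx Hx' xm) addnA.
  rewrite /L Px' 1?mulnC ?Px //; rewrite /N; lia.
split=> // fin; split=> //.
have [D _] := gE (Hx m); have [D' _] := gE (Hx' m).
apply: (@finite_orbit_weak_perron _ _ y (x m)) => //.
- exact/andP.
- by rewrite -x0; exact: trajectory_orbit Hx.
(* The digits at time [m] are 0 and 1 in some order, so the common point lies in both domains. *)
- rewrite -xm in D'; move: am D D'; case: (a m); case: (a' m) => //= _.
    by move=> /andP[-> _] /andP[].
  by move=> /andP[_ ->] /andP[-> _].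
Qed.
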